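(* Let $I=[0,\gamma)$ with $0<\gamma\le\infty$ and let $w$ be a weight function on $I$. Let $\varphi$ and $\varphi_n$ ($n\ge1$) be Orlicz functions such that every $\varphi_n$ satisfies either the $\Delta_\varphi(0)$-condition or the $\Delta_\varphi(\infty)$-condition. Then $(\Lambda_{\varphi,w})_a\setminus\bigcup_{n=1}^\infty\Lambda_{\varphi_n,w}$ is either empty or residual in $(\Lambda_{\varphi,w})_a$.
   Context: The interval $I=[0,\gamma)$ carries Lebesgue measure $m$. $L_0$ is the space of real Lebesgue measurable functions on $I$ modulo a.e. equality. For $f\in L_0$, $d_f(\lambda)=m(\{t\in I:|f(t)|>\lambda\})$ for $\lambda>0$, and $f^*(t)=\inf\{\lambda>0:d_f(\lambda)\le t\}$ for $t\ge 0$ (with $\inf\varnothing=\infty$). An Orlicz function is a convex function $\varphi:[0,\infty)\to[0,\infty)$ with $\varphi(0)=0=\lim_{u\to0}\varphi(u)$ and $\varphi(u)>0$ for $u>0$ (put $\varphi(\infty)=\infty$). An Orlicz function $\psi$ satisfies the $\Delta_\varphi(\infty)$-condition (respectively, the $\Delta_\varphi(0)$-condition) if for every $b>0$ there exists $u_0>0$ such that $\varphi(u)\le\psi(bu)$ for every $u\ge u_0$ (respectively, for every $0\le u\le u_0$). A weight function on $I$ is a positive, decreasing (i.e. nonincreasing) function $w:I\setminus\{0\}\to(0,\infty)$ with $\int_0^t w<\infty$ for every $t\in I$; if $\gamma=\infty$ it is also assumed that $\int_0^\infty w=\infty$. The modular is $\rho_{\varphi,w}(f)=\int_I\varphi(f^*(t))w(t)\,dt$.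 The Orlicz-Lorentz space is $\Lambda_{\varphi,w}=\{f\in L_0:\rho_{\varphi,w}(kf)<\infty\text{ for some }k>0\}$ with the Luxemburg norm $\|f\|_{\varphi,w}=\inf\{\varepsilon>0:\rho_{\varphi,w}(f/\varepsilon)\le1\}$ (a Banach space). $(\Lambda_{\varphi,w})_a$ is its closed subspace of order-continuous elements (those $f$ with $\|f_n\|_{\varphi,w}\downarrow0$ whenever $|f_n|\le|f|$ and $|f_n|\downarrow0$ a.e.), with the induced norm topology; it is well known that $(\Lambda_{\varphi,w})_a=\{f\in L_0:\rho_{\varphi,w}(kf)<\infty\text{ for every }k>0\}$. A subset of a complete metric space is residual if its complement is of first Baire category (equivalently, it contains a countable intersection of dense open sets). *)

(* Defs.v *)
From HB Require Import structures.
From mathcomp Require Import all_boot all_order all_algebra.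
From mathcomp Require Import all_classical all_reals all_analysis.
Set Implicit Arguments.
Unset Strict Implicit.
Unset Printing Implicit Defensive.
Import Order.TTheory GRing.Theory Num.Theory.
Import numFieldNormedType.Exports.
Local Open Scope classical_set_scope.
Local Open Scope ring_scope.

Section Baire_category.
Context {T : topologicalType}.

Definition nowhere_dense (A : set T) : Prop := interior (closure A) = set0.

Definition first_category (A : set T) : Prop :=
  exists F : (set T)^nat, (forall n, nowhere_dense (F n)) /\ A = \bigcup_n F n.

Definition residual (A : set T) : Prop := first_category (~` A).

End Baire_category.

(* [leb R] is the real line with the sigma-algebra of Lebesgue (not just
   Borel) measurable sets, on which [completed_lebesgue_measure] lives. *)
Definition leb (R : realType) : measurableType _ :=
  caratheodory_type ((wlength (@idfun R))^*)%mu.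

Definition lebm (R : realType) : {measure set (leb R) -> \bar R} :=
  @completed_lebesgue_measure R.

Section interval.
Context {R : realType}.
Variable gamma : \bar R.

Definition I_ : set R := [set t | 0 <= t /\ (t%:E < gamma)%E].

(* The domain of a weight function. *)
Definition I0_ : set R := [set t | 0 < t /\ (t%:E < gamma)%E].

Lemma measurable_I_ : measurable (I_ : set (leb R)).
Proof.
apply: sub_caratheodory.
rewrite /I_; case: gamma => [r||].
- rewrite (_ : [set _ | _] = `[0, r[%classic); first exact: measurable_itv.
  by apply/seteqP; split => t /=; rewrite lte_fin in_itv/= => /andP.
- rewrite (_ : [set _ | _] = `[0, +oo[%classic); first exact: measurable_itv.
  apply/seteqP; split => t /=; rewrite ltry in_itv/= andbT; first by case.
  by [].
- rewrite (_ : [set _ | _] = set0); first exact: measurable0.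
  by rewrite -subset0 => t [].
Qed.

Definition lebI : {measure set (leb R) -> \bar R} := mrestr (@lebm R) measurable_I_.

(* L_0: an element is a class of measurable functions on the line for equality
   a.e. on [I_]; every measurable function on [I_] extends to the line, so this
   is the space of classes of measurable functions on [I_]. *)
Definition L0 := {mfun_ lebI, leb R >-> measurableTypeR R}.

Definition L0_fun (f : L0) : R -> R := aqEqMfun_to_fun f.

Definition distribution_fun (f : R -> R) (l : R) : \bar R :=
  lebm R (I_ `&` [set t | l < `|f t|]).

Definition rearrangement (f : R -> R) (t : R) : \bar R :=
  ereal_inf (EFin @` [set l : R | 0 < l /\ (distribution_fun f l <= t%:E)%E]).

End interval.

Coercion L0_fun : L0 >-> Funclass.

(* Functions on [0, +oo[ are encoded by functions on R whose values at negative
   arguments are irrelevant. *)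
Record orlicz_function {R : realType} (phi : R -> R) : Prop := {
  orlicz_ge0 : forall u, 0 <= u -> 0 <= phi u ;
  orlicz_convex : convex_function (`[0, +oo[%classic : set R) phi ;
  orlicz_at0 : phi 0 = 0 ;
  orlicz_cvg0 : phi u @[u --> 0^'+] --> (0 : R) ;
  orlicz_gt0 : forall u, 0 < u -> 0 < phi u }.

Definition Delta_infty {R : realType} (phi psi : R -> R) : Prop :=
  forall b : R, 0 < b -> exists u0 : R, 0 < u0 /\
    forall u, u0 <= u -> phi u <= psi (b * u).

Definition Delta_zero {R : realType} (phi psi : R -> R) : Prop :=
  forall b : R, 0 < b -> exists u0 : R, 0 < u0 /\
    forall u, 0 <= u <= u0 -> phi u <= psi (b * u).

Record weight_function {R : realType} (gamma : \bar R) (w : R -> R) : Prop := {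
  weight_gt0 : forall t, I0_ gamma t -> 0 < w t ;
  weight_nincr : forall s t, I0_ gamma s -> I0_ gamma t -> s <= t -> w t <= w s ;
  weight_lty : forall t, I_ gamma t ->
    (\int[lebm R]_(s in [set s : R | (0 < s <= t)%R]) (w s)%:E < +oo)%E ;
  weight_inty : gamma = +oo%E ->
    (\int[lebm R]_(s in [set s : R | (0 < s)%R]) (w s)%:E = +oo)%E }.

Section Orlicz_Lorentz.
Context {R : realType}.
Variables (gamma : \bar R) (w phi : R -> R).

(* [er_map phi] is phi extended by phi(+oo) = +oo; the integral omits t = 0,
   where w is not defined. *)
Definition modular (f : R -> R) : \bar R :=
  (\int[lebm R]_(t in I0_ gamma)
     (er_map phi (rearrangement gamma f t) * (w t)%:E))%E.

Definition luxemburg (f : R -> R) : \bar R :=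
  ereal_inf (EFin @`
    [set e : R | 0 < e /\ (modular (fun t => (f t / e)%R) <= 1)%E]).

Definition orlicz_lorentz : set (L0 gamma) :=
  [set f : L0 gamma | exists k : R, 0 < k /\ (modular (fun t => (k * f t)%R) < +oo)%E].

Definition order_continuous : set (L0 gamma) :=
  [set f : L0 gamma | orlicz_lorentz f /\
    forall f_ : nat -> L0 gamma,
      (forall n, {ae lebI gamma, forall t, `|f_ n t| <= `|f t|}) ->
      {ae lebI gamma, forall t,
         nonincreasing_seq (fun n => `|f_ n t|) /\
         `|f_ n t| @[n --> \oo] --> (0 : R)} ->
      nonincreasing_seq (fun n => luxemburg (f_ n)) /\
      luxemburg (f_ n) @[n --> \oo] --> 0%E].

Definition order_continuous_space : Type := set_type order_continuous.

Definition to_L0 (f : order_continuous_space) : L0 gamma := \val f.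

HB.instance Definition _ := Choice.on order_continuous_space.

Definition norm_open (U : set order_continuous_space) : Prop :=
  forall f, U f -> exists e : R, 0 < e /\
    forall g, (luxemburg (fun t => (to_L0 g t - to_L0 f t)%R) < e%:E)%E -> U g.

Let norm_openT : norm_open setT.
Proof. by move=> f _; exists 1; split. Qed.

Let norm_openI : setI_closed norm_open.
Proof.
move=> A B oA oB f [/oA [a [a0 Aa]] /oB [b [b0 Bb]]].
exists (Order.min a b); split; first by rewrite lt_min a0.
move=> g gf; split; [apply: Aa|apply: Bb]; apply: (lt_le_trans gf);
  by rewrite lee_fin ge_min lexx ?orbT.
Qed.

Let norm_open_bigU (J : Type) (U : J -> set order_continuous_space) :
  (forall j, norm_open (U j)) -> norm_open (\bigcup_j U j).
Proof.
move=> oU f [j _ /oU [e [e0 Ue]]]; exists e; split => // g /Ue Ug.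
by exists j.
Qed.

HB.instance Definition _ := isOpenTopological.Build order_continuous_space
  norm_openT norm_openI norm_open_bigU.

End Orlicz_Lorentz.

Arguments orlicz_lorentz {R} gamma w phi.
Arguments order_continuous {R} gamma w phi.

Coercion to_L0 : order_continuous_space >-> L0.

(* Main.v *)
Require Import Defs.
From HB Require Import structures.
From mathcomp Require Import all_boot all_order all_algebra.
From mathcomp Require Import all_classical all_reals all_analysis.
From mathcomp Require Import measurable_realfun lra.
Set Implicit Arguments.
Unset Strict Implicit.
Unset Printing Implicit Defensive.
Import Order.TTheory GRing.Theory Num.Theory.
Import numFieldNormedType.Exports.
Local Open Scope classical_set_scope.
Local Open Scope ring_scope.

(** Write [Lambda_psi] for the Orlicz-Lorentz space of [psi] and [X] for the space
    of order continuous elements of [Lambda_phi]. The mechanism is that a proper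
    linear subspace which is a countable union of closed sets is of first
    category: if one of the closed sets had an interior point, the subspace
    would contain a ball, hence everything. So if some [f] in [X] avoids all the
    [Lambda_(phi_n)], each [X `&` Lambda_(phi_n)] is a proper subspace of [X], and
    it remains to exhaust it by countably many sets whose closures stay inside
    [Lambda_(phi_n)]. These sets are the balls [rho_psi (g / m) <= 1], with
    [psi = phi_n] and [m = 1, 2, ...].

    The closure of such a ball stays inside [Lambda_psi] by a Fatou argument
    ([closure_modular_ball]). Norm convergence implies convergence in measure
    ([norm_cvg_in_measure]) because the weight is bounded below near 0;
    convergence in measure makes the rearrangements of the approximants exceed,
    from some point on, every value strictly below the rearrangement of the limit
    ([rearrangement_cvg_in_measure]); and Fatou's lemma applied to the modular
    integrands concludes ([modular_cvg_in_measure]).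

    That [Lambda_psi] and [X] are linear, and that the norm topology behaves as
    expected, all rest on one quasi-triangle inequality ([modular_ball_add]):
    if [|h| <= |f| + |g|] a.e. and [f], [g] lie in the ball of radius [e], then [h]
    lies in the ball of radius [8 e]. It comes from
    [h^* (t) <= f^* (t / 2) + g^* (t / 2)], the monotonicity of the weight, and the
    scaling of Lebesgue measure. For [X], a sequence decreasing to 0 below
    [|f| + |g|] is split into two sequences decreasing to 0 below [|f|] and below
    [|g|] ([order_continuous_add]). *)

(** * Orlicz functions *)

(** Convexity between [u] and 0, where [phi] vanishes. *)
Lemma orlicz_scale {R : realType} (phi : R -> R) : orlicz_function phi ->
  forall c u : R, 0 <= c <= 1 -> 0 <= u -> phi (c * u) <= c * phi u.
Proof.
move=> ophi c u /andP[c0 c1] u0.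
have ge0 (x : R) : 0 <= x -> x \in (`[0, +oo[%classic : set R).
  by move=> x0; rewrite inE/= in_itv/= andbT.
have := orlicz_convex ophi (Itv01 c0 c1) (ge0 u u0) (ge0 0 (lexx 0)).
rewrite convRE (orlicz_at0 ophi) mulr0 addr0.
rewrite [X in phi X](_ : _ = c * u); first exact.
by change (c * u + (1 - c) * 0 = c * u); rewrite mulr0 addr0.
Qed.

Lemma orlicz_homo {R : realType} (phi : R -> R) : orlicz_function phi ->
  forall u v : R, 0 <= u -> u <= v -> phi u <= phi v.
Proof.
move=> ophi u v u0 uv.
have [v0|v0] := leP v 0.
  by have -> : u = v by apply/eqP; rewrite eq_le uv (le_trans v0).
have uv1 : 0 <= u / v <= 1.
  by rewrite divr_ge0 ?(ltW v0)//= ler_pdivrMr// mul1r.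
have := orlicz_scale ophi uv1 (ltW v0); rewrite divfK ?gt_eqF// => /le_trans.
apply; apply: ler_piMl; first exact/(orlicz_ge0 ophi)/ltW.
by case/andP: uv1.
Qed.

Lemma orlicz_unbounded {R : realType} (phi : R -> R) : orlicz_function phi ->
  forall M : R, exists2 u : R, 0 < u & forall v, u <= v -> M < phi v.
Proof.
move=> ophi M; have phi1 := orlicz_gt0 ophi ltr01.
(* The bound [phi u >= u * phi 1], valid for [u >= 1], exceeds [M] at this
   point. *)
pose u := 1 + `|M| / phi 1.
have u1 : 1 <= u by rewrite lerDl divr_ge0// ltW.
have u0 : 0 < u by exact: lt_le_trans u1.
exists u => // v uv; apply: lt_le_trans (orlicz_homo ophi (ltW u0) uv).
have u1' : 0 <= u^-1 <= 1 by rewrite invr_ge0 ltW//= invf_le1.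
have := orlicz_scale ophi u1' (ltW u0).
rewrite mulVf ?gt_eqF// ler_pdivlMl//; apply: lt_le_trans.
rewrite mulrDl mul1r divfK ?gt_eqF//.
by rewrite (le_lt_trans (ler_norm M))// ltrDr.
Qed.

Lemma er_map_ge0 {R : realType} (phi : R -> R) (x : \bar R) :
  orlicz_function phi -> (0 <= x)%E -> (0 <= er_map phi x)%E.
Proof.
by move=> ophi; case: x => [r||]//=; rewrite !lee_fin; exact: orlicz_ge0.
Qed.

Lemma er_map_homo {R : realType} (phi : R -> R) (x y : \bar R) :
  orlicz_function phi -> (0 <= x)%E -> (x <= y)%E ->
  (er_map phi x <= er_map phi y)%E.
Proof.
move=> ophi; case: x => [r||]//; case: y => [s||]//=; rewrite ?leey//.
by rewrite !lee_fin; exact: orlicz_homo.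
Qed.

Lemma er_map_scale {R : realType} (phi : R -> R) (c : R) (x : \bar R) :
  orlicz_function phi -> 0 < c <= 1 -> (0 <= x)%E ->
  (er_map phi (c%:E * x) <= c%:E * er_map phi x)%E.
Proof.
move=> ophi /andP[c0 c1]; case: x => [r||]//= => [r0|_].
  by rewrite -!EFinM lee_fin orlicz_scale// (ltW c0).
by rewrite mulry gtr0_sg// mul1e leey.
Qed.

(** [x + y] is at most twice the larger of [x] and [y], so this is a consequence
    of monotonicity. *)
Lemma er_map_add {R : realType} (phi : R -> R) (x y : \bar R) :
  orlicz_function phi -> (0 <= x)%E -> (0 <= y)%E ->
  (er_map phi (x + y) <= er_map phi (2%:E * x) + er_map phi (2%:E * y))%E.
Proof.
move=> ophi; wlog xy : x y / (x <= y)%E => [wlg x0 y0|x0 y0].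
  have [/wlg|/ltW /wlg] := leP x y; first exact.
  by rewrite (addeC x) (addeC (er_map _ _)); exact.
have h z : (0 <= z -> 0 <= 2%:E * z)%E by move=> z0; rewrite mule_ge0// lee_fin.
apply: (@le_trans _ _ (er_map phi (2%:E * y))%E).
  apply: er_map_homo => //; first exact: adde_ge0.
  by rewrite mule_natl mule2n leeD2r.
by rewrite leeDr// er_map_ge0// h.
Qed.

(** * Integrals on the line *)

Lemma interval_leb {R : realType} (D : set R) :
  is_interval D -> measurable (D : set (leb R)).
Proof. by move=> /is_interval_measurable mD; exact: sub_caratheodory. Qed.

Lemma nonincreasing_emeasurable {R : realType} (D : set R) (f : R -> \bar R) :
  is_interval D -> {in D &, forall s t, s <= t -> (f t <= f s)%E} ->
  measurable_fun (D : set (measurableTypeR R)) f.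
Proof.
move=> iD fD; apply: (measurability (@ErealGenCInfty.G R)).
  exact: ErealGenCInfty.measurableE.
move=> _ [_ [r ->] <-]; apply: is_interval_measurable => s t /=.
rewrite !in_itv/= !andbT => -[Ds fs] [Dt ft] u /andP[su ut].
have Du : D u by apply: (iD s t) => //; apply/andP.
by rewrite in_itv/= andbT; split=> //; rewrite (le_trans ft)// fD// inE.
Qed.

Lemma measurable_leb {R : realType} (D : set R) (f : R -> \bar R) :
  measurable_fun (D : set (measurableTypeR R)) f ->
  measurable (D : set (measurableTypeR R)) ->
  measurable_fun (D : set (leb R)) f.
Proof.
by move=> mf mD _ Y mY; apply: sub_caratheodory; exact: mf.
Qed.

(** Lebesgue measure scales by [c^-1] under [t |-> c * t]; the factor [c = 1]
    compares the completed measure with the Borel one. *)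
Lemma ge0_integral_dilation {R : realType} (c : R) (D : set R)
    (f : R -> \bar R) : 0 < c ->
  measurable (D : set (measurableTypeR R)) ->
  measurable_fun (D : set (measurableTypeR R)) f ->
  (forall t, D t -> 0 <= f t)%E ->
  (\int[lebm R]_(t in [set t | D (c * t)%R]) f (c * t)%R =
   (c^-1)%:E * \int[@lebesgue_measure R]_(t in D) f t)%E.
Proof.
move=> c0 mD mf f0.
pose dil : leb R -> measurableTypeR R := fun t => c * t.
have mdil : measurable_fun setT dil.
  move=> _ Y mY; apply: sub_caratheodory.
  have : measurable_fun [set: measurableTypeR R]
      ((fun t => c * t) : _ -> measurableTypeR R).
    exact: mulrl_measurable.
  exact.
transitivity (\int[pushforward (lebm R) dil]_(t in D) f t)%E.
  by rewrite ge0_integral_pushforward// => t; rewrite inE; exact: f0.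
have c'0 : 0 <= c^-1 by rewrite invr_ge0 ltW.
pose k : {nonneg R} := NngNum c'0.
rewrite -[(c^-1)%R]/(k%:num) -ge0_integral_mscale//.
apply: eq_measure_integral => A mA _.
have E : forall A : set R, measurable (A : set (measurableTypeR R)) ->
   (c%:E * lebm R (dil @^-1` A) = lebesgue_measure A)%E.
  move=> B mB; have c0' := ltW c0; pose l : {nonneg R} := NngNum c0'.
  apply/esym; apply: (lebesgue_measure_unique
    (mu := mscale l (pushforward (lebm R) dil))) => // _ [[a b]] _ <-.
  rewrite /= /mscale/= /pushforward.
  have -> : dil @^-1` `]a, b] = `]a / c, b / c]%classic.
    apply/seteqP; split => t /=; rewrite !in_itv/= ltr_pdivrMr// ler_pdivlMr//;
      by rewrite mulrC.
  rewrite -[completed_lebesgue_measure _]/(lebesgue_measure _).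
  rewrite !lebesgue_measure_itv/= !lte_fin ltr_pM2r ?invr_gt0//.
  case: ifPn => _; last by rewrite mule0.
  by rewrite -!EFinD -EFinM -mulrBl mulrC divfK ?gt_eqF.
change (lebm R (dil @^-1` A) = (c^-1)%:E * lebesgue_measure A)%E.
by rewrite -E// muleA -EFinM mulVf ?gt_eqF// mul1e.
Qed.

(** * Decreasing rearrangements *)

Notation leb_measurable f :=
  (measurable_fun [set: leb _] (f : leb _ -> measurableTypeR _)).

#[local] Instance ae_lebI_filter {R : realType} (gamma : \bar R) :
  Filter (nbhs (almost_everywhere (lebI gamma))).
Proof. exact: ae_filter_ringOfSetsType. Qed.

Section rearrangement.
Context {R : realType} (gamma : \bar R).
Implicit Types f g h : R -> R.

Lemma lebm_le_ae (A B : set (leb R)) : measurable A -> measurable B ->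
  {ae lebI gamma, forall t, A t -> B t} ->
  (lebm R (I_ gamma `&` A) <= lebm R (I_ gamma `&` B))%E.
Proof.
move=> mA mB [N [mN N0 AB]].
have mI := @measurable_I_ R gamma.
have {}N0 : lebm R (I_ gamma `&` N) = 0%E by rewrite setIC.
apply: (@le_trans _ _ (lebm R ((I_ gamma `&` B) `|` (I_ gamma `&` N)))).
  apply: le_measure; rewrite ?inE; first exact: measurableI.
    by apply: measurableU; exact: measurableI.
  move=> t [It At]; have [Nt|Nt] := pselect (N t); [by right|left; split => //].
  by apply: contrapT => nBt; apply/Nt/AB => /(_ At).
rewrite -[leRHS]adde0 -N0; apply: measureU2; exact: measurableI.
Qed.

Lemma measurable_gt_norm h (l : R) : leb_measurable h ->
  measurable ([set t | l < `|h t|] : set (leb R)).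
Proof.
move=> mh.
have mnh : leb_measurable (fun t => `|h t|) by exact: measurableT_comp mh.
have := mnh measurableT `]l, +oo[%classic (measurable_itv _).
rewrite setTI; congr (measurable _).
by apply/seteqP; split => t /=; rewrite in_itv/= andbT.
Qed.

(** Where [|h|] exceeds [a + b], either [|f|] exceeds [a] or [|g|] exceeds [b]. *)
Lemma distribution_add f g h (a b : R) :
  leb_measurable f -> leb_measurable g -> leb_measurable h ->
  {ae lebI gamma, forall t, `|h t| <= `|f t| + `|g t|} ->
  (distribution_fun gamma h (a + b) <=
   distribution_fun gamma f a +
   distribution_fun gamma g b)%E.
Proof.
move=> mf mg mh hfg; have mI := @measurable_I_ R gamma.
have mA := measurable_gt_norm a mf; have mB := measurable_gt_norm b mg.
rewrite /distribution_fun.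
apply: (@le_trans _ _ (lebm R (I_ gamma `&`
    ([set t | a < `|f t|] `|` [set t | b < `|g t|])))).
  apply: lebm_le_ae; [exact: measurable_gt_norm|exact: measurableU|].
  move: hfg; apply: filterS => t hfg /= abh.
  have [fa|] := leP `|f t| a; last by left.
  right; move: (lt_le_trans abh hfg) fa; lra.
by rewrite setIUr; apply: measureU2; exact: measurableI.
Qed.

Lemma distribution_nincr h (a b : R) : leb_measurable h -> a <= b ->
  (distribution_fun gamma h b <=
   distribution_fun gamma h a)%E.
Proof.
move=> mh ab; apply: lebm_le_ae; [exact: measurable_gt_norm..|].
by apply: aeW => t /=; exact: le_lt_trans.
Qed.

Lemma distribution_scale h (c l : R) : 0 < c ->
  distribution_fun gamma (fun t => c * h t) (c * l) =
  distribution_fun gamma h l.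
Proof.
move=> c0; congr (lebm R (_ `&` _)); apply/seteqP.
by split => t /=; rewrite normrM gtr0_norm// ltr_pM2l.
Qed.

Lemma rearrangement_ge0 h (t : R) : (0 <= rearrangement gamma h t)%E.
Proof. by apply/ereal_infP => _ [l [l0 _] <-]; rewrite lee_fin ltW. Qed.

Lemma rearrangement_le h (l t : R) : 0 < l ->
  (distribution_fun gamma h l <= t%:E)%E ->
  (rearrangement gamma h t <= l%:E)%E.
Proof. by move=> l0 hl; apply: ge_ereal_inf; exists l%:E => //; exists l. Qed.

Lemma le_rearrangement h (l t : R) : leb_measurable h ->
  (t%:E < distribution_fun gamma h l)%E ->
  (l%:E <= rearrangement gamma h t)%E.
Proof.
move=> mh tl; apply/ereal_infP => _ [k [k0 kt] <-]; rewrite lee_fin leNgt.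
apply/negP => /ltW kl; have := le_trans (distribution_nincr mh kl) kt.
by rewrite leNgt tl.
Qed.

Lemma lt_rearrangement h (l t : R) : 0 < l ->
  (l%:E < rearrangement gamma h t)%E ->
  (t%:E < distribution_fun gamma h l)%E.
Proof.
by move=> l0; rewrite !ltNge; apply: contra; exact: rearrangement_le.
Qed.

Lemma rearrangement_lt h (l t : R) : leb_measurable h ->
  (rearrangement gamma h t < l%:E)%E ->
  0 < l /\ (distribution_fun gamma h l <= t%:E)%E.
Proof.
move=> mh /ereal_inf_lt[_ [k [k0 kt] <-]]; rewrite lte_fin => kl.
split; first exact: lt_trans kl.
exact: le_trans (distribution_nincr mh (ltW kl)) kt.
Qed.

Lemma rearrangement_nincr h (s t : R) : s <= t ->
  (rearrangement gamma h t <= rearrangement gamma h s)%E.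
Proof.
move=> st; apply: ereal_inf_le_tmp => _ [l [l0 ls] <-]; exists l => //.
by split => //; apply: le_trans ls _; rewrite lee_fin.
Qed.

Lemma rearrangement_add f g h (s t : R) :
  leb_measurable f -> leb_measurable g -> leb_measurable h ->
  {ae lebI gamma, forall t, `|h t| <= `|f t| + `|g t|} ->
  (rearrangement gamma h (s + t) <=
   rearrangement gamma f s + rearrangement gamma g t)%E.
Proof.
move=> mf mg mh hfg.
have := rearrangement_ge0 g t; have := rearrangement_ge0 f s.
case Ef : (rearrangement gamma f s) => [x||]//=; last first.
  by move=> _ gt0; rewrite addye ?leey//; case: rearrangement gt0.
case Eg : (rearrangement gamma g t) => [y||]//= _ _; last by rewrite leey.
apply/lee_addgt0Pr => e e0; rewrite -!EFinD.
have e20 : 0 < e / 2 by rewrite divr_gt0.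
have [a0 da] : 0 < x + e / 2 /\
    (distribution_fun gamma f (x + e / 2)%R <= s%:E)%E.
  by apply: rearrangement_lt => //; rewrite Ef lte_fin ltrDl.
have [b0 db] : 0 < y + e / 2 /\
    (distribution_fun gamma g (y + e / 2)%R <= t%:E)%E.
  by apply: rearrangement_lt => //; rewrite Eg lte_fin ltrDl.
have -> : x + y + e = (x + e / 2) + (y + e / 2) by lra.
apply: rearrangement_le; first exact: addr_gt0.
apply: le_trans (distribution_add _ _ mf mg mh hfg) _.
by rewrite EFinD leeD.
Qed.

Lemma rearrangement_dominated f h (t : R) :
  leb_measurable f -> leb_measurable h ->
  {ae lebI gamma, forall t, `|h t| <= `|f t|} ->
  (rearrangement gamma h t <= rearrangement gamma f t)%E.
Proof.
move=> mf mh hf; apply: ereal_inf_le_tmp => _ [l [l0 lt] <-]; exists l => //.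
split => //; apply: le_trans lt; apply: lebm_le_ae;
  [exact: measurable_gt_norm..|].
by move: hf; apply: filterS => u hf /= /lt_le_trans; exact.
Qed.

Lemma rearrangement_scale h (c t : R) : leb_measurable h -> 0 < c ->
  (rearrangement gamma (fun t => (c * h t)%R) t <=
   c%:E * rearrangement gamma h t)%E.
Proof.
move=> mh c0; have := rearrangement_ge0 h t.
case Eh : (rearrangement gamma h t) => [x||]//= _; last first.
  by rewrite mulry gtr0_sg// mul1e leey.
apply/lee_addgt0Pr => e e0; rewrite -EFinM -EFinD.
have [a0 da] : 0 < x + e / c /\
    (distribution_fun gamma h (x + e / c)%R <= t%:E)%E.
  by apply: rearrangement_lt => //; rewrite Eh lte_fin ltrDl divr_gt0.
have -> : c * x + e = c * (x + e / c) by rewrite mulrDr mulrCA divff ?gt_eqF// mulr1.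
by apply: rearrangement_le; [exact: mulr_gt0|rewrite distribution_scale].
Qed.

End rearrangement.

(** * The modular and its balls *)

Section modular.
Context {R : realType} (gamma : \bar R) (w : R -> R).
Hypothesis ww : weight_function gamma w.
Implicit Types f g h phi : R -> R.

Lemma is_interval_I0 : is_interval (I0_ gamma).
Proof.
move=> s t [s0 _] [_ tg] u /andP[su ut]; split; first exact: lt_le_trans su.
by apply: le_lt_trans tg; rewrite lee_fin.
Qed.

Lemma I0_le (s t : R) : 0 < s -> s <= t -> I0_ gamma t -> I0_ gamma s.
Proof.
by move=> s0 st [_ tg]; split=> //; apply: le_lt_trans tg; rewrite lee_fin.
Qed.

Definition modular_integrand phi f (t : R) : \bar R :=
  (er_map phi (rearrangement gamma f t) * (w t)%:E)%E.

Lemma modular_integrand_ge0 phi f (t : R) : orlicz_function phi ->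
  I0_ gamma t -> (0 <= modular_integrand phi f t)%E.
Proof.
move=> ophi It; rewrite mule_ge0 ?er_map_ge0 ?rearrangement_ge0//.
by rewrite lee_fin ltW// (weight_gt0 ww).
Qed.

(** Monotonicity is also what makes the integrand Borel measurable. *)
Lemma modular_integrand_nincr phi f : orlicz_function phi ->
  {in I0_ gamma &, forall s t, s <= t ->
    (modular_integrand phi f t <= modular_integrand phi f s)%E}.
Proof.
move=> ophi s t; rewrite !inE => Is It st; apply: lee_pmul.
- by rewrite er_map_ge0 ?rearrangement_ge0.
- by rewrite lee_fin ltW// (weight_gt0 ww).
- by rewrite er_map_homo ?rearrangement_ge0 ?rearrangement_nincr.
- by rewrite lee_fin (weight_nincr ww).
Qed.

Lemma measurable_I0 : measurable (I0_ gamma : set (leb R)).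
Proof. by apply: interval_leb; exact: is_interval_I0. Qed.

Lemma measurable_modular_integrand phi f : orlicz_function phi ->
  measurable_fun (I0_ gamma : set (leb R)) (modular_integrand phi f).
Proof.
move=> ophi; apply: measurable_leb.
  apply: nonincreasing_emeasurable; first exact: is_interval_I0.
  exact: modular_integrand_nincr.
by apply: is_interval_measurable; exact: is_interval_I0.
Qed.

Lemma modular_dominated phi f h : orlicz_function phi ->
  leb_measurable f -> leb_measurable h ->
  {ae lebI gamma, forall t, `|h t| <= `|f t|} ->
  (modular gamma w phi h <= modular gamma w phi f)%E.
Proof.
move=> ophi mf mh hf; apply: ge0_le_integral; first exact: measurable_I0.
- by move=> t; exact: modular_integrand_ge0.
- exact: measurable_modular_integrand.
- exact: measurable_modular_integrand.
move=> t It; apply: lee_wpmul2r.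
  by rewrite lee_fin ltW// (weight_gt0 ww).
by rewrite er_map_homo ?rearrangement_ge0//; exact: rearrangement_dominated.
Qed.

Lemma modular_ge0 phi f : orlicz_function phi ->
  (0 <= modular gamma w phi f)%E.
Proof.
by move=> ophi; apply: integral_ge0 => t; exact: modular_integrand_ge0.
Qed.

Lemma modular_scale phi f (c : R) : orlicz_function phi ->
  leb_measurable f -> 0 < c <= 1 ->
  (modular gamma w phi (fun t => (c * f t)%R) <=
   c%:E * modular gamma w phi f)%E.
Proof.
move=> ophi mf /[dup] c01 /andP[c0 c1].
rewrite -(ge0_integralZl_EFin (lebm R) measurable_I0
  (fun t => modular_integrand_ge0 f ophi)
  (measurable_modular_integrand f ophi) (ltW c0)).
apply: ge0_le_integral; first exact: measurable_I0.
- by move=> t; exact: modular_integrand_ge0.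
- exact: measurable_modular_integrand.
- by apply: measurable_funeM; exact: measurable_modular_integrand.
move=> t It; rewrite muleA; apply: lee_wpmul2r.
  by rewrite lee_fin ltW// (weight_gt0 ww).
apply: le_trans (er_map_scale ophi c01 (rearrangement_ge0 _ _ _)).
by rewrite er_map_homo ?rearrangement_ge0//; exact: rearrangement_scale.
Qed.

Lemma halved_integrand_ge0 phi f (t : R) : orlicz_function phi ->
  I0_ gamma t ->
  (0 <= er_map phi (rearrangement gamma f (2^-1 * t)%R) * (w t)%:E)%E.
Proof.
move=> ophi It; rewrite mule_ge0 ?er_map_ge0 ?rearrangement_ge0//.
by rewrite lee_fin ltW// (weight_gt0 ww).
Qed.

Lemma measurable_halved_integrand phi f : orlicz_function phi ->
  measurable_fun (I0_ gamma : set (leb R)) (fun t =>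
    er_map phi (rearrangement gamma f (2^-1 * t)%R) * (w t)%:E)%E.
Proof.
move=> ophi; apply: measurable_leb; last first.
  by apply: is_interval_measurable; exact: is_interval_I0.
apply: nonincreasing_emeasurable; first exact: is_interval_I0.
move=> s t; rewrite !inE => Is It st; apply: lee_pmul.
- by rewrite er_map_ge0 ?rearrangement_ge0.
- by rewrite lee_fin ltW// (weight_gt0 ww).
- by rewrite er_map_homo ?rearrangement_ge0 ?rearrangement_nincr ?ler_pM2l.
- by rewrite lee_fin (weight_nincr ww).
Qed.

(** As [w] is nonincreasing, [w t] may be replaced by [w (t / 2)], after which
    the substitution [t = 2 s] applies. *)
Lemma modular_halved_argument phi f : orlicz_function phi ->
  (\int[lebm R]_(t in I0_ gamma)
     (er_map phi (rearrangement gamma f (2^-1 * t)%R) * (w t)%:E) <=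
   2%:E * modular gamma w phi f)%E.
Proof.
move=> ophi; pose D := [set t : R | I0_ gamma (2^-1 * t)].
have iD : is_interval D.
  move=> s t Ds Dt u /andP[su ut]; apply: (is_interval_I0 Ds Dt).
  by rewrite !ler_pM2l// su.
have I0D : I0_ gamma `<=` D.
  move=> t It; have [t0 _] := It; apply: I0_le It; first exact: mulr_gt0.
  by move: t0; lra.
have mD := interval_leb iD; have mI := measurable_I0.
have mI' : measurable (I0_ gamma : set (measurableTypeR R)).
  by apply: is_interval_measurable; exact: is_interval_I0.
pose F (t : R) := modular_integrand phi f (2^-1 * t).
have F0 t : D t -> (0 <= F t)%E by exact: modular_integrand_ge0.
have mF : measurable_fun (D : set (leb R)) F.
  apply: measurable_leb; last exact: is_interval_measurable.
  apply: nonincreasing_emeasurable => // s t; rewrite !inE => Ds Dt st.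
  by apply: modular_integrand_nincr; rewrite ?inE// ler_pM2l.
apply: (@le_trans _ _ (\int[lebm R]_(t in I0_ gamma) F t)%E).
  apply: (ge0_le_integral (lebm R) mI).
  - by move=> t; exact: halved_integrand_ge0.
  - exact: measurable_halved_integrand.
  - exact: (measurable_funS mD I0D mF).
  - move=> t It; apply: lee_wpmul2l; first by rewrite er_map_ge0 ?rearrangement_ge0.
    have [t0 _] := It; rewrite lee_fin (weight_nincr ww)//; first exact: I0D.
    by move: t0; lra.
apply: (@le_trans _ _ (\int[lebm R]_(t in D) F t)%E).
  exact: (ge0_subset_integral (lebm R) mI mD mF F0 I0D).
have mH : measurable_fun (I0_ gamma : set (measurableTypeR R))
    (modular_integrand phi f).
  apply: nonincreasing_emeasurable; first exact: is_interval_I0.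
  exact: modular_integrand_nincr.
have H0 t : I0_ gamma t -> (0 <= modular_integrand phi f t)%E.
  exact: modular_integrand_ge0.
have := ge0_integral_dilation (_ : 0 < 2^-1) mI' mH H0.
rewrite invr_gt0 ltr0n => /(_ isT); rewrite invrK -/D -/F => ->.
have := ge0_integral_dilation ltr01 mI' mH H0.
rewrite invr1 mul1e => <-.
rewrite (_ : [set t | _] = I0_ gamma); last first.
  by apply/seteqP; split => t /=; rewrite mul1r.
by under eq_integral do rewrite mul1r.
Qed.

End modular.

Section modular_ball.
Context {R : realType} (gamma : \bar R) (w : R -> R).
Hypothesis ww : weight_function gamma w.
Implicit Types f g h phi : R -> R.

Lemma leb_measurable_div f (e : R) :
  leb_measurable f -> leb_measurable (fun t => f t / e).
Proof. by move=> mf; exact: (measurable_funM mf (measurable_cst _)). Qed.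

(** The ball of radius [e] of the Luxemburg functional, described by the modular
    so that estimates avoid the infimum defining the functional. *)
Definition modular_ball phi (e : R) f : Prop :=
  (modular gamma w phi (fun t => (f t / e)%R) <= 1)%E.

Lemma modular_ball_dominated phi (e : R) f h : orlicz_function phi -> 0 < e ->
  leb_measurable f -> leb_measurable h ->
  {ae lebI gamma, forall t, `|h t| <= `|f t|} ->
  modular_ball phi e f -> modular_ball phi e h.
Proof.
move=> ophi e0 mf mh hf; apply: le_trans; apply: (modular_dominated ww ophi).
- exact: leb_measurable_div.
- exact: leb_measurable_div.
move: hf; apply: filterS => t hf.
by rewrite !normrM ler_wpM2r.
Qed.

Lemma modular_ball_le phi (e e' : R) f : orlicz_function phi -> 0 < e ->
  leb_measurable f -> e <= e' -> modular_ball phi e f -> modular_ball phi e' f.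
Proof.
move=> ophi e0 mf ee'; apply: le_trans; apply: (modular_dominated ww ophi).
- exact: leb_measurable_div.
- exact: leb_measurable_div.
have e'0 := lt_le_trans e0 ee'.
apply: aeW => t; rewrite !normrM ler_wpM2l// !gtr0_norm ?invr_gt0//.
by rewrite lef_pV2.
Qed.

Lemma modular_ball_scale phi (c e : R) f : 0 < c -> modular_ball phi e f ->
  modular_ball phi (c * e) (fun t => c * f t).
Proof.
rewrite /modular_ball => c0 fe.
have -> : (fun t => c * f t / (c * e)) = (fun t => f t / e).
  by apply/funext => t; rewrite -mulf_div divff ?gt_eqF// mul1r.
exact: fe.
Qed.

(** The factor 8 makes the arguments shrink by 4, and convexity turns this into
    a factor 1/4 on the modulars: two summands, each doubled by halving the
    argument of its rearrangement. *)
Lemma modular_ball_add phi (e : R) f g h : orlicz_function phi -> 0 < e ->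
  leb_measurable f -> leb_measurable g -> leb_measurable h ->
  {ae lebI gamma, forall t, `|h t| <= `|f t| + `|g t|} ->
  modular_ball phi e f -> modular_ball phi e g -> modular_ball phi (8 * e) h.
Proof.
move=> ophi e0 mf mg mh hfg bf bg.
pose F t := f t / e; pose G t := g t / e.
have mF : leb_measurable F by exact: leb_measurable_div.
have mG : leb_measurable G by exact: leb_measurable_div.
have mF8 : leb_measurable (fun t => 8^-1 * F t).
  exact: (measurable_funM (measurable_cst _) mF).
have mG8 : leb_measurable (fun t => 8^-1 * G t).
  exact: (measurable_funM (measurable_cst _) mG).
pose A f t := (er_map phi (rearrangement gamma f (2^-1 * t)%R) * (w t)%:E)%E.
have A0 f' t : I0_ gamma t -> (0 <= A f' t)%E.
  exact: (halved_integrand_ge0 ww).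
have mA f' : measurable_fun (I0_ gamma : set (leb R)) (A f').
  exact: (measurable_halved_integrand ww).
have c4 : 0 < (4^-1 : R) <= 1 by lra.
have c4' : 0 <= (4^-1 : R) by lra.
have cA0 f' t : I0_ gamma t -> (0 <= (4^-1)%:E * A f' t)%E.
  by move=> It; rewrite mule_ge0 ?A0.
have mcA f' : measurable_fun (I0_ gamma : set (leb R))
    (fun t => ((4^-1)%:E * A f' t)%E).
  exact: measurable_funeM.
have mI := measurable_I0 gamma.
have intA f' : modular_ball phi e f' ->
    (\int[lebm R]_(t in I0_ gamma) ((4^-1)%:E * A (fun t => f' t / e)%R t) <=
     (2^-1)%:E)%E.
  move=> b.
  rewrite (ge0_integralZl_EFin (lebm R) mI (A0 _) (mA _) c4').
  have -> : 2^-1 = 4^-1 * 2 :> R by lra.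
  rewrite EFinM lee_pmul2l ?lte_fin//.
  apply: le_trans (modular_halved_argument ww _ ophi) _.
  by rewrite -[leRHS]mule1 lee_pmul2l// lte_fin.
rewrite /modular_ball.
apply: (@le_trans _ _ (\int[lebm R]_(t in I0_ gamma)
   ((4^-1)%:E * A F t + (4^-1)%:E * A G t))%E); last first.
  rewrite (ge0_integralD (lebm R) mI (cA0 F) (mcA F) (cA0 G) (mcA G)).
  have -> : 1%E = ((2^-1)%:E + (2^-1)%:E : \bar R)%E.
    by rewrite -EFinD; congr EFin; lra.
  by apply: leeD; exact: intA.
apply: (ge0_le_integral (lebm R) mI).
- by move=> t; exact: (modular_integrand_ge0 ww).
- exact: (measurable_modular_integrand ww).
- exact: emeasurable_funD.
move=> t It; rewrite !muleA -ge0_muleDl; last 2 first.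
- by rewrite mule_ge0 ?er_map_ge0 ?rearrangement_ge0.
- by rewrite mule_ge0 ?er_map_ge0 ?rearrangement_ge0.
apply: lee_wpmul2r; first by rewrite lee_fin ltW// (weight_gt0 ww).
have quarter (u : R -> R) : leb_measurable u ->
    (er_map phi (2%:E * rearrangement gamma (fun t => (8^-1 * u t)%R) (2^-1 * t)%R) <=
     (4^-1)%:E * er_map phi (rearrangement gamma u (2^-1 * t)%R))%E.
  move=> mu.
  apply: le_trans (er_map_scale ophi c4 (rearrangement_ge0 _ _ _)).
  apply: er_map_homo => //.
    by rewrite mule_ge0 ?rearrangement_ge0.
  have -> : 4^-1 = 2 * 8^-1 :> R by lra.
  rewrite EFinM -muleA lee_pmul2l ?lte_fin//.
  by apply: rearrangement_scale; rewrite // invr_gt0.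
apply: le_trans (leeD (quarter _ mF) (quarter _ mG)).
apply: le_trans (er_map_add ophi (rearrangement_ge0 _ _ _) (rearrangement_ge0 _ _ _)).
apply: er_map_homo => //; first exact: rearrangement_ge0.
(* The argument of the rearrangement has to be shared between the summands. *)
have -> : t = 2^-1 * t + 2^-1 * t by lra.
have -> : 2^-1 * (2^-1 * t + 2^-1 * t) = 2^-1 * t by lra.
apply: (rearrangement_add _ _ mF8 mG8 (leb_measurable_div _ mh)).
move: hfg; apply: filterS => s hfg.
have E0 : 0 < (8 * e)^-1 by rewrite invr_gt0 mulr_gt0.
have E x : `|8^-1 * (x / e)| = `|x| / (8 * e).
  by rewrite mulrCA -invfM normrM (gtr0_norm E0).
by rewrite /F /G !E normrM (gtr0_norm E0) -mulrDl ler_pM2r.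
Qed.

End modular_ball.

(** * Convergence in measure and Fatou's lemma for the modular *)

Lemma limn_einf_ge {R : realType} (u : (\bar R)^nat) (c : \bar R) :
  (\forall n \near \oo, (c <= u n)%E) -> (c <= limn_einf u)%E.
Proof.
move=> [N _ cu]; rewrite limn_einf_lim; apply: lime_ge; first exact: is_cvg_einfs.
exists N => // n /= Nn; apply/ereal_infP => _ [m /= nm <-].
by apply: cu; exact: leq_trans nm.
Qed.

Lemma limn_einf_le {R : realType} (u : (\bar R)^nat) (c : \bar R) :
  (forall n, (u n <= c)%E) -> (limn_einf u <= c)%E.
Proof.
move=> uc; rewrite limn_einf_lim; apply: lime_le; first exact: is_cvg_einfs.
apply: nearW => n; apply: ge_ereal_inf; exists (u n) => //.
by exists n => /=.
Qed.

Section convergence.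
Context {R : realType} (gamma : \bar R) (w : R -> R).
Hypothesis ww : weight_function gamma w.
Implicit Types f g h phi psi : R -> R.

(** A Chebyshev inequality: if [|h| > a] on a set of measure exceeding [t], the
    rearrangement of [h / e] is at least [a / e] on [`]0, t]], where the weight is
    at least [w t], so its modular is at least [phi (a / e) * (w t * t)]. *)
Lemma distribution_modular_ball phi (e a t : R) h : orlicz_function phi ->
  0 < e -> leb_measurable h -> I0_ gamma t ->
  1 < phi (a / e) * (w t * t) -> 0 < a -> modular_ball gamma w phi e h ->
  (distribution_fun gamma h a <= t%:E)%E.
Proof.
move=> ophi e0 mh It big a0 he; rewrite leNgt; apply/negP => ta.
move: he; rewrite /modular_ball leNgt => /negP; apply.
have [t0 _] := It; have wt0 := weight_gt0 ww It.
have mhe := leb_measurable_div e mh.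
have ae s : s <= t -> ((a / e)%:E <= rearrangement gamma (fun t => h t / e)%R s)%E.
  move=> st; apply: le_rearrangement => //.
  have -> : (fun t => h t / e) = (fun t => e^-1 * h t).
    by apply/funext => u; rewrite mulrC.
  rewrite mulrC distribution_scale ?invr_gt0//.
  by apply: le_lt_trans ta; rewrite lee_fin.
have ae0 : 0 <= a / e by rewrite divr_ge0// ltW.
pose J : set (leb R) := `]0, t]%classic.
have mJ : measurable J.
  by apply: interval_leb; exact: interval_is_interval.
have JI : J `<=` I0_ gamma.
  by move=> s; rewrite /J/= in_itv/= => /andP[s0 st]; exact: (I0_le s0 st).
have mI := measurable_I0 gamma.
have mH := measurable_modular_integrand ww (fun t => h t / e) ophi.
have H0 := fun s => modular_integrand_ge0 ww (fun t => h t / e) ophi (t := s).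
have low : (1 < \int[lebm R]_(s in J) (phi (a / e) * w t)%:E)%E.
  rewrite integral_cst//.
  have -> : lebm R J = t%:E.
    rewrite -[LHS]/(lebesgue_measure `]0, t]%classic) lebesgue_measure_itv/=.
    by rewrite lte_fin t0 -EFinD subr0.
  by rewrite -EFinM lte_fin -mulrA.
apply: lt_le_trans low _.
apply: le_trans (ge0_subset_integral (lebm R) mJ mI mH H0 JI).
apply: (ge0_le_integral (lebm R) mJ).
- by move=> s _; rewrite lee_fin mulr_ge0 ?(orlicz_ge0 ophi)// ltW.
- exact: measurable_cst.
- exact: (measurable_funS mI JI mH).
move=> s Js; have Is := JI _ Js.
move: Js; rewrite /J/= in_itv/= => /andP[s0 st].
rewrite EFinM; apply: lee_pmul.
- by rewrite lee_fin (orlicz_ge0 ophi).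
- by rewrite lee_fin ltW.
- rewrite -[X in (X <= _)%E]/(er_map phi (a / e)%:E).
  by apply: er_map_homo; rewrite ?lee_fin//; exact: ae.
- by rewrite lee_fin (weight_nincr ww).
Qed.

(** The distribution functions control rearrangements from below only up to a
    small shift of the argument, which right-continuity of the rearrangement
    absorbs: [b < f^* s] already forces [s] to be strictly below the measure of
    the points where [f] exceeds some level above [b]. *)
Lemma rearrangement_cvg_in_measure (g : nat -> R -> R) f (b s : R) :
  leb_measurable f -> (forall n, leb_measurable (g n)) ->
  (forall e : R, 0 < e -> \forall n \near \oo,
    (distribution_fun gamma (fun t => f t - g n t)%R e <= e%:E)%E) ->
  0 < b -> (b%:E < rearrangement gamma f s)%E ->
  \forall n \near \oo, (b%:E <= rearrangement gamma (g n) s)%E.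
Proof.
move=> mf mg gf b0 bf.
have [b' bb' b'f] : exists2 b', b < b' & (b'%:E < rearrangement gamma f s)%E.
  move: bf; case: (rearrangement gamma f s) => [r||]//.
    rewrite lte_fin => br; exists ((b + r) / 2); first by move: br; lra.
    by rewrite lte_fin; move: br; lra.
  by move=> _; exists (b + 1); [lra|rewrite ltry].
have [d d0 sd] : exists2 d : R, 0 < d &
    ((s + d)%:E < distribution_fun gamma f b')%E.
  move: (lt_rearrangement (lt_trans b0 bb') b'f).
  case: (distribution_fun gamma f b') => [r||]//.
    rewrite lte_fin => sr; exists ((r - s) / 2); first by move: sr; lra.
    by rewrite lte_fin; move: sr; lra.
  by move=> _; exists 1 => //; rewrite ltry.
pose e := Num.min d (b' - b).
have e0 : 0 < e by rewrite lt_min d0 subr_gt0.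
have ed : e <= d by rewrite ge_min lexx.
have eb : b + e <= b' by rewrite addrC -lerBrDr ge_min lexx orbT.
have := gf e e0; apply: filterS => n fgn.
apply: le_rearrangement => //; rewrite ltNge; apply/negP => gs.
move: sd; rewrite ltNge => /negP; apply.
apply: le_trans (distribution_nincr gamma mf eb) _.
have mfg : leb_measurable (fun t => f t - g n t) by exact: (measurable_funB mf (mg n)).
have ae : {ae lebI gamma, forall t, `|f t| <= `|g n t| + `|f t - g n t|}.
  apply: aeW => t.
  by have := ler_normD (g n t) (f t - g n t); rewrite (addrC (g n t)) subrK.
apply: le_trans (distribution_add _ _ (mg n) mfg mf ae) _.
by rewrite EFinD leeD// (le_trans fgn)// lee_fin.
Qed.

(** Where the rearrangement of [f] is finite and positive, half of it is a value
    strictly below it, which the rearrangements of the [g n] exceed from some [n]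
    on; where it is infinite, they tend to infinity. Fatou's lemma then applies to
    the integrands of the modulars. *)
Lemma modular_cvg_in_measure psi (g : nat -> R -> R) f : orlicz_function psi ->
  leb_measurable f -> (forall n, leb_measurable (g n)) ->
  (forall e : R, 0 < e -> \forall n \near \oo,
    (distribution_fun gamma (fun t => f t - g n t)%R e <= e%:E)%E) ->
  (forall n, (modular gamma w psi (g n) <= 1)%E) ->
  modular_ball gamma w psi 2 f.
Proof.
move=> opsi mf mg gf g1.
have mI := measurable_I0 gamma.
have mG n := measurable_modular_integrand ww (g n) opsi.
have G0 n := fun s => modular_integrand_ge0 ww (g n) opsi (t := s).
rewrite /modular_ball; apply: le_trans (limn_einf_le g1).
apply: le_trans (fatou (lebm R) mI mG G0).
apply: (ge0_le_integral (lebm R) mI).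
- by move=> t; exact: (modular_integrand_ge0 ww).
- exact: (measurable_modular_integrand ww).
- have mN n : measurable_fun (I0_ gamma : set (leb R))
      (fun s => - modular_integrand gamma w psi (g n) s)%E.
    exact: (measurableT_comp (@oppe_measurable R setT) (mG n)).
  exact: (measurableT_comp (@oppe_measurable R setT) (measurable_fun_limn_esup mN)).
move=> s Is; have ws0 := weight_gt0 ww Is.
have half : (rearrangement gamma (fun t => f t / 2)%R s <=
    (2^-1)%:E * rearrangement gamma f s)%E.
  have -> : (fun t => f t / 2) = (fun t => 2^-1 * f t).
    by apply/funext => t; rewrite mulrC.
  by apply: rearrangement_scale; rewrite // invr_gt0.
have := rearrangement_ge0 gamma f s.
case Ef : (rearrangement gamma f s) => [r||]//.
  rewrite lee_fin le_eqVlt => /predU1P[r0|r0].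
    apply: limn_einf_ge; apply: nearW => n.
    apply: (@le_trans _ _ 0%E); last exact: G0.
    rewrite /modular_integrand.
    have -> : rearrangement gamma (fun t => f t / 2)%R s = 0%E.
      apply/eqP; rewrite eq_le rearrangement_ge0 andbT.
      by apply: le_trans half _; rewrite Ef -r0 mule0.
    by rewrite /= (orlicz_at0 opsi) mul0e.
  have r20 : 0 < r / 2 by rewrite divr_gt0.
  have : ((r / 2)%:E < rearrangement gamma f s)%E.
    by rewrite Ef lte_fin; move: r0; lra.
  move=> /(rearrangement_cvg_in_measure mf mg gf r20) near_g.
  apply: limn_einf_ge; move: near_g; apply: filterS => n rg.
  apply: lee_wpmul2r; first by rewrite lee_fin ltW.
  apply: er_map_homo => //; first exact: rearrangement_ge0.
  by apply: le_trans half _; rewrite Ef -EFinM mulrC.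
move=> _; suff -> : limn_einf (fun n => modular_integrand gamma w psi (g n) s)
  = +oo%E by rewrite leey.
apply/eqyP => A A0.
have [u u0 uA] := orlicz_unbounded opsi (A / w s).
have : (u%:E < rearrangement gamma f s)%E by rewrite Ef ltry.
move=> /(rearrangement_cvg_in_measure mf mg gf u0) near_g.
apply: limn_einf_ge; move: near_g; apply: filterS => n ug.
have -> : A%:E = ((A / w s)%:E * (w s)%:E)%E.
  by rewrite -EFinM divfK ?gt_eqF.
apply: lee_wpmul2r; first by rewrite lee_fin ltW.
apply: le_trans (er_map_homo opsi _ ug); last by rewrite lee_fin ltW.
by rewrite lee_fin ltW// uA.
Qed.

End convergence.

(** * The Luxemburg functional and order continuous elements *)

Section space.
Context {R : realType} (gamma : \bar R) (w : R -> R).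
Hypothesis ww : weight_function gamma w.
Implicit Types f g h phi psi : R -> R.
Local Notation ball := (modular_ball gamma w).

Lemma L0_measurable (f : L0 gamma) : leb_measurable f.
Proof. exact: measurable_funPT. Qed.

(** The functions constructed below have to be brought back into [L0], whose
    elements have representatives known only up to a null set. *)
Lemma L0_lift h : leb_measurable h ->
  exists u : L0 gamma, {ae lebI gamma, forall t, u t = h t}.
Proof.
move=> mh.
pose H : {mfun leb R >-> measurableTypeR R} :=
  HB.pack (h : leb R -> measurableTypeR R) (isMeasurableFun.Build _ _ _ _ _ mh).
exists (\pi_(L0 gamma) H)%qT.
have /eqmodP/asboolP : (repr (\pi_(L0 gamma) H) = H %[mod (L0 gamma)])%qT.
  by rewrite reprK.
by apply: filterS => t; exact.
Qed.

(** Dividing by a large constant brings a finite modular below 1, by convexity. *)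
Lemma orlicz_lorentzP phi (f : L0 gamma) : orlicz_function phi ->
  orlicz_lorentz gamma w phi f <-> exists2 e, 0 < e & ball phi e f.
Proof.
move=> ophi; have mf := L0_measurable f; split => [[k [k0 kf]]|[e e0 fe]].
  have mkf : leb_measurable (fun t => k * f t).
    exact: (measurable_funM (measurable_cst _) mf).
  have := modular_ge0 ww (fun t => k * f t) ophi.
  move: kf; case Er : (modular _ _ _ _) => [r||]// _; rewrite lee_fin => r0.
  have r10 : 0 < (1 + r)^-1 by rewrite invr_gt0 ltr_wpDr.
  exists ((1 + r)^-1 * k)^-1; first by rewrite invr_gt0 mulr_gt0.
  have c01 : 0 < (1 + r)^-1 <= 1.
    by rewrite r10/= invf_le1 ?lerDl// ltr_wpDr.
  rewrite /modular_ball.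
  have -> : (fun t => f t / ((1 + r)^-1 * k)^-1) =
      (fun t => (1 + r)^-1 * (k * f t)).
    by apply/funext => t; rewrite invrK mulrC mulrA.
  apply: le_trans (modular_scale ww ophi mkf c01) _.
  rewrite Er -EFinM lee_fin ler_pdivrMl ?ltr_wpDr// mulr1.
  by rewrite lerDr.
exists e^-1; split; first by rewrite invr_gt0.
apply: (@le_lt_trans _ _ 1%E); last exact: ltry.
move: fe; rewrite /modular_ball.
have -> : (fun t => f t / e) = (fun t => e^-1 * f t).
  by apply/funext => t; rewrite mulrC.
exact.
Qed.

Lemma luxemburg_ge0 phi f : (0 <= luxemburg gamma w phi f)%E.
Proof. by apply/ereal_infP => _ [e [e0 _] <-]; rewrite lee_fin ltW. Qed.

Lemma luxemburg_le phi (e : R) f : 0 < e -> ball phi e f ->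
  (luxemburg gamma w phi f <= e%:E)%E.
Proof. by move=> e0 fe; apply: ge_ereal_inf; exists e%:E => //; exists e. Qed.

Lemma luxemburg_lt phi (e : R) f : orlicz_function phi -> leb_measurable f ->
  (luxemburg gamma w phi f < e%:E)%E -> 0 < e /\ ball phi e f.
Proof.
move=> ophi mf /ereal_inf_lt[_ [d [d0 fd] <-]]; rewrite lte_fin => de.
split; first exact: lt_trans de.
exact: (modular_ball_le ww ophi d0 mf (ltW de) fd).
Qed.

Lemma luxemburg_dominated phi f h : orlicz_function phi ->
  leb_measurable f -> leb_measurable h ->
  {ae lebI gamma, forall t, `|h t| <= `|f t|} ->
  (luxemburg gamma w phi h <= luxemburg gamma w phi f)%E.
Proof.
move=> ophi mf mh hf; apply: ereal_inf_le_tmp => _ [e [e0 fe] <-].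
exists e; last by []. split; first by [].
exact: (modular_ball_dominated ww ophi e0 mf mh hf fe).
Qed.

Lemma ball_ex_add phi f g h : orlicz_function phi ->
  leb_measurable f -> leb_measurable g -> leb_measurable h ->
  {ae lebI gamma, forall t, `|h t| <= `|f t| + `|g t|} ->
  (exists2 e, 0 < e & ball phi e f) -> (exists2 e, 0 < e & ball phi e g) ->
  exists2 e, 0 < e & ball phi e h.
Proof.
move=> ophi mf mg mh hfg [a a0 fa] [b b0 gb].
have m0 : 0 < Num.max a b by rewrite lt_max a0.
exists (8 * Num.max a b); first exact: mulr_gt0.
apply: (modular_ball_add ww ophi m0 mf mg mh hfg).
  by apply: (modular_ball_le ww ophi a0 mf _ fa); rewrite le_max lexx.
by apply: (modular_ball_le ww ophi b0 mg _ gb); rewrite le_max lexx orbT.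
Qed.

Lemma luxemburg_cvg0 phi (f_ : nat -> R -> R) : orlicz_function phi ->
  (forall n, leb_measurable (f_ n)) ->
  luxemburg gamma w phi (f_ n) @[n --> \oo] --> 0%E <->
  (forall e, 0 < e -> \forall n \near \oo, ball phi e (f_ n)).
Proof.
move=> ophi mf; split => [/fine_cvgP[fin cv] e e0|near_ball].
  have /cvgr0Pnorm_lt/(_ e e0) cve := cv.
  near=> n.
  have Fin : luxemburg gamma w phi (f_ n) \is a fin_num by near: n.
  suff : (luxemburg gamma w phi (f_ n) < e%:E)%E.
    by case/(luxemburg_lt ophi (mf n)).
  rewrite -(fineK Fin) lte_fin; apply: le_lt_trans (ler_norm _) _.
  by near: n.
have near_le e : 0 < e ->
    \forall n \near \oo, (luxemburg gamma w phi (f_ n) <= e%:E)%E.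
  by move=> e0; apply: filterS (near_ball e e0) => n; exact: luxemburg_le.
apply/fine_cvgP; split.
  apply: filterS (near_le 1 ltr01) => n le1.
  by rewrite ge0_fin_numE ?luxemburg_ge0//; apply: le_lt_trans le1 _; exact: ltry.
apply/cvgr0Pnorm_le => e e0; apply: filterS (near_le e e0) => n le1.
rewrite /= ger0_norm ?fine_ge0 ?luxemburg_ge0//.
have Fin : luxemburg gamma w phi (f_ n) \is a fin_num.
  by rewrite ge0_fin_numE ?luxemburg_ge0//; apply: le_lt_trans le1 _; exact: ltry.
by rewrite -lee_fin fineK.
Unshelve. all: by end_near. Qed.

(** Riesz decomposition: if [|h_n|] decreases to 0 below [|f| + |g|], then its
    part [min |h_n| |f|] and the remainder both decrease to 0, below [|f|] and
    [|g|] respectively. *)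
Lemma order_continuous_add phi (f g h : L0 gamma) : orlicz_function phi ->
  {ae lebI gamma, forall t, `|h t| <= `|f t| + `|g t|} ->
  order_continuous gamma w phi f -> order_continuous gamma w phi g ->
  order_continuous gamma w phi h.
Proof.
move=> ophi hfg [Lf ocf] [Lg ocg].
have mL (u : L0 gamma) : leb_measurable u by exact: L0_measurable.
have mN (u : R -> R) : leb_measurable u -> leb_measurable (fun t => `|u t|).
  by move=> mu; exact: (measurableT_comp (@normr_measurable R setT) mu).
split.
  apply/(orlicz_lorentzP _ ophi).
  move: Lf Lg => /(orlicz_lorentzP _ ophi) Lf /(orlicz_lorentzP _ ophi) Lg.
  exact: (ball_ex_add ophi (mL f) (mL g) (mL h) hfg Lf Lg).
move=> h_ h_h h_0; split.
  move=> m n mn; apply: (luxemburg_dominated ophi (mL _) (mL _)).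
  by move: h_0; apply: filterS => t [ni _]; exact: ni.
have mmin n : leb_measurable (fun t => Num.min `|h_ n t| `|f t|).
  exact: (measurable_minr (mN _ (mL _)) (mN _ (mL _))).
have mrem n : leb_measurable (fun t => `|h_ n t| - Num.min `|h_ n t| `|f t|).
  exact: (measurable_funB (mN _ (mL _)) (mmin n)).
pose u n := projT1 (cid (L0_lift (mmin n))).
have uE : {ae lebI gamma, forall t, forall n, u n t = Num.min `|h_ n t| `|f t|}.
  by apply: ae_foralln => n; rewrite /u; case: cid.
pose v n := projT1 (cid (L0_lift (mrem n))).
have vE : {ae lebI gamma, forall t,
    forall n, v n t = `|h_ n t| - Num.min `|h_ n t| `|f t|}.
  by apply: ae_foralln => n; rewrite /v; case: cid.
have min_le (a b : R) : Num.min a b <= a by rewrite ge_min lexx.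
have u0 t : (forall n, u n t = Num.min `|h_ n t| `|f t|) ->
    forall n, `|u n t| = Num.min `|h_ n t| `|f t|.
  by move=> ut n; rewrite ut ger0_norm// le_min !normr_ge0.
have v0 t : (forall n, v n t = `|h_ n t| - Num.min `|h_ n t| `|f t|) ->
    forall n, `|v n t| = `|h_ n t| - Num.min `|h_ n t| `|f t|.
  by move=> vt n; rewrite vt ger0_norm// subr_ge0.
have squeeze (a b : nat -> R) : (forall n, 0 <= a n <= b n) ->
    b n @[n --> \oo] --> 0 -> a n @[n --> \oo] --> 0.
  move=> ab b0; apply: (squeeze_cvgr _ (cvg_cst 0) b0).
  by apply: nearW => n; exact: ab.
have cvu : luxemburg gamma w phi (u n) @[n --> \oo] --> 0%E.
  apply: (ocf u _ _).2.
    move=> n; move: uE; apply: filterS => t /u0 ->.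
    by rewrite ge_min lexx orbT.
  move: h_0 uE; apply: filterS2 => t [ni cv] /u0 ut; split.
    move=> m n mn; rewrite !ut le_min ge_min ni//= ge_min lexx orbT//.
  apply: squeeze cv => n; rewrite ut min_le andbT.
  by rewrite le_min !normr_ge0.
have cvv : luxemburg gamma w phi (v n) @[n --> \oo] --> 0%E.
  apply: (ocg v _ _).2.
    move=> n; move: hfg (h_h n) vE; apply: filterS3 => t hfgt hht /v0 ->.
    have := le_trans hht hfgt; have := normr_ge0 (g t).
    by have [] := leP `|h_ n t| `|f t|; lra.
  move: h_0 vE; apply: filterS2 => t [ni cv] /v0 vt; split.
    move=> m n mn; rewrite !vt; have := ni _ _ mn.
    by have [] := leP `|h_ n t| `|f t|; have [] := leP `|h_ m t| `|f t|; lra.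
  apply: squeeze cv => n; rewrite vt subr_ge0 min_le/=.
  by rewrite lerBlDr lerDl le_min !normr_ge0.
apply/(luxemburg_cvg0 ophi (fun n => mL (h_ n))) => e e0.
have e80 : 0 < 8^-1 * e by rewrite mulr_gt0 ?invr_gt0.
move: cvu => /(luxemburg_cvg0 ophi (fun n => mL (u n))) /(_ _ e80).
move: cvv => /(luxemburg_cvg0 ophi (fun n => mL (v n))) /(_ _ e80).
apply: filterS2 => n vn un.
have -> : e = 8 * (8^-1 * e) by rewrite mulrA divff// mul1r.
apply: (modular_ball_add ww ophi e80 (mL _) (mL _) (mL _) _ un vn).
move: uE vE; apply: filterS2 => t /u0 -> /v0 ->.
by rewrite addrC subrK.
Qed.

End space.

(** * Baire category *)

Section category.
Context {R : realType} (gamma : \bar R) (w phi : R -> R).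
Hypothesis gamma_gt0 : (0 < gamma)%E.
Hypothesis ww : weight_function gamma w.
Hypothesis ophi : orlicz_function phi.
Implicit Types (f g h psi : R -> R).
Local Notation ball := (modular_ball gamma w).
Local Notation OC := (order_continuous_space gamma w phi).

(** With [c <= 1], [c * f] is dominated by [f], so that it is order continuous
    together with [f]. *)
Lemma small_multiple f (e : R) : leb_measurable f -> 0 < e ->
  (exists2 a, 0 < a & ball phi a f) ->
  exists2 c, 0 < c <= 1 & (luxemburg gamma w phi (fun t => (c * f t)%R) < e%:E)%E.
Proof.
move=> mf e0 [a a0 fa].
have b0 : 0 < e / (2 * a) by rewrite divr_gt0// mulr_gt0.
pose c := Num.min 1 (e / (2 * a)).
have c0 : 0 < c by rewrite lt_min ltr01.
exists c; first by rewrite c0/= ge_min lexx.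
apply: (@le_lt_trans _ _ (c * a)%:E).
  by apply: luxemburg_le; [exact: mulr_gt0|exact: modular_ball_scale].
rewrite lte_fin; apply: (@le_lt_trans _ _ (e / 2)); last by move: e0; lra.
apply: (@le_trans _ _ (e / (2 * a) * a)); first by rewrite ler_pM2r// ge_min lexx orbT.
by rewrite invfM mulrA divfK ?gt_eqF.
Qed.

Lemma OC_measurable (f : OC) : leb_measurable f.
Proof. exact: L0_measurable. Qed.

Lemma OC_ball (f : OC) : exists2 a, 0 < a & ball phi a f.
Proof.
by have [Lf _] := set_valP f; exact: (orlicz_lorentzP ww _ ophi).1 Lf.
Qed.

Lemma measurable_subOC (f g : OC) : leb_measurable (fun t => f t - g t).
Proof. exact: (measurable_funB (OC_measurable f) (OC_measurable g)). Qed.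

(** The points around which some ball is contained in the given one form an open
    set: by the quasi-triangle inequality, if the ball of radius [d] around [f]
    is contained in it, then so is the ball of radius [d / 16] around each point
    at distance less than [d / 16] from [f]. *)
Lemma norm_ball_nbhs (g : OC) (e : R) : 0 < e ->
  nbhs g [set f : OC | (luxemburg gamma w phi (fun t => (f t - g t)%R) < e%:E)%E].
Proof.
move=> e0; pose B := [set f : OC |
  (luxemburg gamma w phi (fun t => (f t - g t)%R) < e%:E)%E].
pose U := [set f : OC | exists d : R, 0 < d /\ forall h : OC,
  (luxemburg gamma w phi (fun t => (h t - f t)%R) < d%:E)%E -> B h].
rewrite nbhsE; exists U.
  split; last by exists e.
  suff : norm_open U by [].
  move=> f [d [d0 dB]]; have d16 : 0 < d / 16 by rewrite divr_gt0.
  exists (d / 16); split => // h hf; exists (d / 16); split => // k kh.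
  apply: dB.
  have [_ bhf] := luxemburg_lt ww ophi (measurable_subOC h f) hf.
  have [_ bkh] := luxemburg_lt ww ophi (measurable_subOC k h) kh.
  apply: (@le_lt_trans _ _ (8 * (d / 16))%:E); last by rewrite lte_fin; move: d0; lra.
  apply: luxemburg_le; first exact: mulr_gt0.
  apply: (modular_ball_add ww ophi d16 (measurable_subOC k h)
    (measurable_subOC h f) (measurable_subOC k f) _ bkh bhf).
  by apply: aeW => t; exact: ler_distD.
move=> f [d [d0]]; apply.
have [c _] := small_multiple (OC_measurable f) d0 (OC_ball f).
apply: le_lt_trans.
apply: (luxemburg_dominated ww ophi _ (measurable_subOC f f)).
  exact: (measurable_funM (measurable_cst _) (OC_measurable f)).
by apply: aeW => t; rewrite subrr normr0.
Qed.

(** Fix [t <= a] in the domain of the weight. As [phi] is unbounded,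
    [phi (a / e n) * (w t * t)] exceeds 1 once [e n] is small, and the Chebyshev
    inequality bounds the distribution function at [a] by [t]. *)
Lemma norm_cvg_in_measure (h : nat -> R -> R) (e : nat -> R) (a : R) :
  (forall n, leb_measurable (h n)) -> (forall n, 0 < e n) ->
  e n @[n --> \oo] --> 0 -> (forall n, ball phi (e n) (h n)) -> 0 < a ->
  \forall n \near \oo, (distribution_fun gamma (h n) a <= a%:E)%E.
Proof.
move=> mh e0 ecv bh a0.
have [t It ta] : exists2 t, I0_ gamma t & t <= a.
  have : (0 < mine gamma a%:E)%E by rewrite lt_min gamma_gt0 lte_fin.
  case E : (mine gamma a%:E) => [r||]//; last first.
    have : (mine gamma a%:E <= a%:E)%E by rewrite ge_min lexx orbT.
    by rewrite E.
  rewrite lte_fin => r0; exists (r / 2).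
    split; first exact: divr_gt0.
    apply: (@lt_le_trans _ _ r%:E); first by rewrite lte_fin; move: r0; lra.
    by rewrite -E ge_min lexx.
  have : (mine gamma a%:E <= a%:E)%E by rewrite ge_min lexx orbT.
  by rewrite E lee_fin; move: r0; lra.
have [t0 _] := It; have wt := mulr_gt0 (weight_gt0 ww It) t0.
have [u u0 uphi] := orlicz_unbounded ophi (w t * t)^-1.
have au0 : 0 < a / u by exact: divr_gt0.
have /cvgr0Pnorm_le/(_ _ au0) := ecv; apply: filterS => n.
rewrite (gtr0_norm (e0 n)) => eau.
apply: (@le_trans _ _ t%:E); last by rewrite lee_fin.
apply: (distribution_modular_ball ww ophi (e0 n) (mh n) It _ a0 (bh n)).
rewrite -ltr_pdivrMr// mul1r; apply: uphi.
by rewrite ler_pdivlMr// mulrC -ler_pdivlMr.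
Qed.

(** A point of the closure is a norm limit, hence a limit in measure, of elements
    of the ball. *)
Lemma closure_modular_ball psi (m : R) (g : OC) : orlicz_function psi -> 0 < m ->
  closure [set f : OC | ball psi m f] g -> exists2 e, 0 < e & ball psi e g.
Proof.
move=> opsi m0 clg; exists (2 * m); first exact: mulr_gt0.
have approx n : exists y : OC, ball psi m y /\
    ball phi n.+1%:R^-1 (fun t => g t - y t).
  have n0 : 0 < n.+1%:R^-1 :> R by rewrite invr_gt0.
  have [y [/= yF]] := clg _ (norm_ball_nbhs g n0).
  move=> /(luxemburg_lt ww ophi (measurable_subOC y g))[_ yg].
  exists y; split; first exact: yF.
  apply: (modular_ball_dominated ww ophi n0 (measurable_subOC y g)
    (measurable_subOC g y) _ yg).
  by apply: aeW => t; rewrite distrC.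
have [y yP] := choice approx.
have yF n : ball psi m (y n) := (yP n).1.
have yg n : ball phi n.+1%:R^-1 (fun t => g t - y n t) := (yP n).2.
have m'0 : 0 < m^-1 by rewrite invr_gt0.
have ecv : m^-1 * n.+1%:R^-1 @[n --> \oo] --> (0 : R).
  by rewrite -(mulr0 m^-1); apply: cvgMr; exact: cvg_harmonic.
have mdiv (f : OC) := leb_measurable_div m (OC_measurable f).
have cv (a : R) : 0 < a -> \forall n \near \oo,
    (distribution_fun gamma (fun t => g t / m - y n t / m)%R a <= a%:E)%E.
  move=> a0.
  refine (norm_cvg_in_measure (e := fun n => m^-1 * n.+1%:R^-1)
    _ _ ecv _ a0).
  - by move=> n; exact: (measurable_funB (mdiv g) (mdiv (y n))).
  - by move=> n; rewrite mulr_gt0// invr_gt0.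
  - move=> n; have := modular_ball_scale m'0 (yg n).
  have -> : (fun t => m^-1 * (g t - y n t)) = (fun t => g t / m - y n t / m).
    by apply/funext => t; rewrite -mulrBl mulrC.
  exact.
have := modular_cvg_in_measure ww opsi (mdiv g) (fun n => mdiv (y n)) cv yF.
rewrite /modular_ball.
have -> : (fun t => g t / m / 2) = (fun t => g t / (2 * m)).
  by apply/funext => t; rewrite invfM mulrA mulrAC.
exact.
Qed.

(** If the closure had an interior point [x], a norm ball around [x] would be
    contained in [Lambda_psi]. It contains [x] and [x + c * f] for a small [c > 0],
    so that [c * f], and then [f], would belong to [Lambda_psi]. *)
Lemma modular_ball_nowhere_dense psi (m : R) : orlicz_function psi -> 0 < m ->
  (exists2 f : OC, True & ~ orlicz_lorentz gamma w psi f) ->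
  nowhere_dense [set f : OC | ball psi m f].
Proof.
move=> opsi m0 [f _ nf]; apply/seteqP; split=> [/= x|//].
change OC in (type of x).
rewrite /interior /= nbhsE => -[U [oU Ux] UF]; exfalso; apply: nf.
have {}oU : norm_open U by [].
have [e [e0 eU]] := oU _ Ux.
apply/(orlicz_lorentzP ww _ opsi).
have [c /andP[c0 c1] cf] := small_multiple (OC_measurable f) e0 (OC_ball f).
have mcf : leb_measurable (fun t => c * f t).
  exact: (measurable_funM (measurable_cst _) (OC_measurable f)).
have mg : leb_measurable (fun t => x t + c * f t).
  exact: (measurable_funD (OC_measurable x) mcf).
have [g gE] := @L0_lift _ gamma _ mg.
have ocg : order_continuous gamma w phi g.
  apply: (order_continuous_add ww ophi _ (set_valP x) (set_valP f)).
  move: gE; apply: filterS => t ->.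
  apply: le_trans (ler_normD _ _) _; rewrite lerD2l normrM (gtr0_norm c0).
  by rewrite ler_piMl.
pose G : OC := SigSub (mem_set ocg).
have UG : U G.
  apply: eU; apply: le_lt_trans cf.
  apply: (luxemburg_dominated ww ophi mcf (measurable_subOC G x)).
  by move: gE; apply: filterS => t; rewrite /to_L0/= => ->; rewrite addrC addKr.
have bx := closure_modular_ball opsi m0 (UF _ Ux).
have bG := closure_modular_ball opsi m0 (UF _ UG).
have [d d0 fd] : exists2 d, 0 < d & ball psi d (fun t => c * f t).
  apply: (ball_ex_add ww opsi (OC_measurable G) (OC_measurable x) mcf _ bG bx).
  move: gE; apply: filterS => t; rewrite /to_L0/= => ->.
  rewrite -[X in `|X| <= _](addKr (x t)) addrC.
  exact: ler_normB.
have c'0 : 0 < c^-1 by rewrite invr_gt0.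
exists (c^-1 * d); first exact: mulr_gt0.
have := modular_ball_scale c'0 fd.
have -> : (fun t => c^-1 * (c * f t)) = f.
  by apply/funext => t; rewrite mulKf ?gt_eqF.
exact.
Qed.

End category.

Theorem theorem4p16 (R : realType) (gamma : \bar R) (w phi : R -> R)
    (phi_ : nat -> R -> R) :
  (0 < gamma)%E ->
  weight_function gamma w ->
  orlicz_function phi ->
  (forall n, orlicz_function (phi_ n)) ->
  (forall n, Delta_zero phi (phi_ n) \/ Delta_infty phi (phi_ n)) ->
  let E : set (L0 gamma) :=
    order_continuous gamma w phi `\` \bigcup_n orlicz_lorentz gamma w (phi_ n) in
  E = set0 \/
  residual [set f : order_continuous_space gamma w phi | E f].
Proof.
move=> g0 ww ophi ophi_ _ E.
have [->|/set0P[f [ocf nf]]] := eqVneq E set0; [by left|right].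
(* The pairs (index of the Orlicz function, radius of the ball) are enumerated
   by [pickle]. *)
pose F k : set (order_continuous_space gamma w phi) :=
  if unpickle k is Some (n, j)
  then [set f : order_continuous_space gamma w phi | modular_ball gamma w (phi_ n) j.+1%:R f] else set0.
exists F; split.
  move=> k; rewrite /F; case: unpickle => [[n j]|].
    apply: (modular_ball_nowhere_dense g0 ww ophi (ophi_ n)) => //.
    exists (SigSub (mem_set ocf)) => // Lf.
    by apply: nf; exists n.
  by rewrite /nowhere_dense closure0 interior0.
apply/seteqP.
split => g; change (order_continuous_space gamma w phi) in (type of g).
  move=> nEg.
  have [n Lg] : exists n, orlicz_lorentz gamma w (phi_ n) g.
    apply: contrapT => nL; apply: nEg; split; first exact: set_valP.
    by move=> [n _ Lg]; apply: nL; exists n.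
  move: Lg => /(orlicz_lorentzP ww _ (ophi_ n))[e e0 ge].
  have [j ej] : exists j : nat, e <= j.+1%:R.
    exists (Num.truncn e); exact/ltW/truncnS_gt.
  exists (pickle (n, j)) => //; rewrite /F pickleK /=.
  exact: (modular_ball_le ww (ophi_ n) e0 (L0_measurable _) ej ge).
move=> [k _]; rewrite /F; case: unpickle => [[n j]|]//= gj [_]; apply; exists n => //.
by apply/(orlicz_lorentzP ww _ (ophi_ n)); exists j.+1%:R.
Qed.
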